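(* For $s-q\ge m\ge 1$, the natural bound and the spectral bound for the Data-Fusion problem satisfy $\mathfrak{z}_{\mathcal{N}}\le\mathfrak{z}_{\mathcal{S}}$.
   Context: Let $G\in\mathbb{R}^{p\times m}$, $H\in\mathbb{R}^{q\times m}$, $B:=H^\top H$ positive definite, $P:=\{1,\dots,p\}$, and $s$ an integer with $0<s-q<p$. The Data-Fusion problem is $\max\{\operatorname{ldet}(B+G^\top\operatorname{Diag}(x)G):\mathbf{e}^\top x=s-q,\ x\in\{0,1\}^p\}$, where $\operatorname{ldet}$ is log-determinant, $\mathbf{e}$ the all-ones vector, $\operatorname{Diag}(x)$ the diagonal matrix with diagonal $x$. $\lambda_i(X)$ denotes the $i$-th largest eigenvalue of a symmetric matrix $X$. Natural bound: $\mathfrak{z}_{\mathcal{N}}:=\max\{\operatorname{ldet}(B+G^\top\operatorname{Diag}(x)G):\mathbf{e}^\top x=s-q,\ 0\le x_i\le1\ (i\in P)\}$. Spectral bound: $\mathfrak{z}_{\mathcal{S}}:=\operatorname{ldet}(B)+\sum_{i=1}^{s-q}\log\big(1+\lambda_i(GB^{-1}G^\top)\big)$. *)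

(* Defs.v *)
From mathcomp Require Import all_boot all_order all_algebra.
From mathcomp Require Import fingroup perm complex.
From mathcomp Require Import all_classical all_reals all_analysis.

Set Implicit Arguments.
Unset Strict Implicit.
Unset Printing Implicit Defensive.

Import Order.TTheory GRing.Theory Num.Theory.
Import numFieldNormedType.Exports.

Local Open Scope classical_set_scope.
Local Open Scope ring_scope.

Definition posdef (R : realType) (n : nat) (A : 'M[R]_n) : Prop :=
  A^T = A /\ forall v : 'cV[R]_n, v != 0 -> 0 < (v^T *m A *m v) 0 0.

(* [ln] is total, with value 0 on nonpositive reals; [ldet] is only applied
   below to [B] and to [B + G^T Diag(x) G] with [x >= 0], which are positive
   definite as soon as [B] is (see [posdef_fusion] and [posdef_det_gt0]). *)
Definition ldet (R : realType) (n : nat) (A : 'M[R]_n) : R := ln (\det A).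

(* [is_spectrum A l]: [l] lists the eigenvalues of [A] in nonincreasing order,
   repeated according to algebraic multiplicity. *)
Definition is_spectrum (R : realType) (n : nat) (A : 'M[R]_n) (l : seq R) :
    Prop :=
  sorted >=%R l /\ char_poly A = \prod_(a <- l) ('X - a%:P).

(* Indices start at 1.  [is_spectrum A] has exactly one element when [A] is
   symmetric (see [spectrum_symmetric] and [is_spectrum_uniq]); the default
   value [[::]] is used only when the characteristic polynomial of [A] does
   not split over [R]. *)
Definition lambda (R : realType) (n : nat) (i : nat) (A : 'M[R]_n) : R :=
  nth 0 (xget [::] [set l | is_spectrum A l]) i.-1.

(* The greatest element of a set of reals, 0 if there is none; the maximum in
   [natural_bound] exists when [H^T H] is positive definite and [s - q <= p]
   (see [natural_bound_attained]). *)
Definition max_value (R : realType) (V : set R) : R :=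
  xget 0 [set v | V v /\ ubound V v].

Definition fusion_relaxed (R : realType) (p k : nat) : set 'rV[R]_p :=
  [set x | \sum_(i < p) x 0 i = k%:R /\ forall i : 'I_p, 0 <= x 0 i <= 1].

Definition fusion_objective (R : realType) (p m : nat) (G : 'M[R]_(p, m))
    (B : 'M[R]_m) (x : 'rV[R]_p) : R :=
  ldet (B + G^T *m diag_mx x *m G).

(* [s - q] is truncated subtraction; it is meant for [q < s]. *)
Definition natural_bound (R : realType) (p q m s : nat) (G : 'M[R]_(p, m))
    (H : 'M[R]_(q, m)) : R :=
  max_value (fusion_objective G (H^T *m H) @` @fusion_relaxed R p (s - q)%N).

Definition spectral_bound (R : realType) (p q m s : nat) (G : 'M[R]_(p, m))
    (H : 'M[R]_(q, m)) : R :=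
  let B := H^T *m H in
  ldet B +
  \sum_(1 <= i < (s - q).+1) ln (1 + lambda i (G *m invmx B *m G^T)).

Lemma is_spectrum_uniq (R : realType) (n : nat) (A : 'M[R]_n) (l l' : seq R) :
  is_spectrum A l -> is_spectrum A l' -> l = l'.
Proof.
move=> [sl cl] [sl' cl'].
apply: (sorted_eq (leT := >=%R)) => //.
- exact: rev_trans le_trans.
- by move=> x y; rewrite andbC; exact: le_anti.
- by apply: prod_XsubC_eq; rewrite -cl -cl'.
Qed.

Lemma spectrum_symmetric (R : realType) (n : nat) (A : 'M[R]_n) :
  A^T = A -> exists l, is_spectrum A l.
Proof.
move=> symA; pose f := real_complex R; pose AC := map_mx f A.
have AC_herm : AC \is hermsymmx.
  apply/is_hermitianmxP; rewrite expr0 scale1r; apply/matrixP => i j.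
  rewrite !mxE -[in RHS]symA mxE; apply/esym/CrealP.
  by apply/complex_realP; exists (A i j).
have /orthomx_spectralP ACE := hermitian_normalmx AC_herm.
have Dreal := hermitian_spectral_diag_real AC_herm.
have Pu := spectral_unit AC.
set D := spectral_diag AC in ACE Dreal.
set P := spectralmx AC in ACE Pu.
exists (sort >=%R [seq complex.Re (D 0 i) | i : 'I_n]); split.
  by apply: sort_sorted => x y; rewrite orbC; exact: le_total.
rewrite (perm_big [seq complex.Re (D 0 i) | i : 'I_n]) /=; last first.
  by rewrite perm_sort.
rewrite big_image /=; apply: (map_poly_inj f); rewrite map_char_poly -/AC.
have -> : char_poly AC = char_poly (diag_mx D).
  rewrite /char_poly {1}ACE /char_poly_mx; pose Q := map_mx polyC P.
  have QV : map_mx polyC (invmx P) *m Q = 1%:M.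
    by rewrite -map_mxM mulVmx // map_mx1.
  have -> : 'X%:M - map_mx polyC (invmx P *m diag_mx D *m P) =
      map_mx polyC (invmx P) *m ('X%:M - map_mx polyC (diag_mx D)) *m Q.
    rewrite mulmxBr mulmxBl !map_mxM /=; congr (_ - _).
    by rewrite scalar_mxC -mulmxA QV mulmx1.
  by rewrite !det_mulmx mulrC mulrA -det_mulmx mulmx1C // det1 mul1r.
rewrite char_poly_trig ?diag_mx_trig //.
rewrite rmorph_prod; apply: eq_bigr => i _.
rewrite rmorphB /= map_polyX map_polyC /= mxE eqxx mulr1n.
congr ('X - _%:P); apply/esym/RRe_real.
by have /mxOverP := Dreal; apply.
Qed.

Lemma posdef_det_gt0 (R : realType) (n : nat) (A : 'M[R]_n) :
  posdef A -> 0 < \det A.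
Proof.
move=> [sA pA]; have [l [_ cl]] := spectrum_symmetric sA.
have lpos a : a \in l -> 0 < a.
  move=> al; have : root (char_poly A) a by rewrite cl root_prod_XsubC.
  rewrite -eigenvalue_root_char => /eigenvalueP[v vA v0].
  have := pA v^T; rewrite trmx_eq0 trmxK => /(_ v0).
  rewrite vA -scalemxAl mxE [X in _ * X]mxE.
  under eq_bigr do rewrite mxE -expr2.
  move=> h; have s0 : 0 <= \sum_j v 0 j ^+ 2 by apply: sumr_ge0 => j _; exact: sqr_ge0.
  rewrite ltNge; apply/negP => a0.
  by move: h; rewrite ltNge; rewrite mulr_le0_ge0.
have := char_poly_det A; rewrite cl -horner_coef0 horner_prod.
move=> /(congr1 ( *%R ((-1) ^+ n))); rewrite mulrA -expr2 sqrr_sign mul1r => <-.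
have -> : n = size l.
  by have := size_char_poly A; rewrite cl size_prod_XsubC => -[].
elim: l lpos {cl} => [|a l IH] lp; first by rewrite !big_nil mulr1.
rewrite big_cons /= exprS hornerXsubC sub0r mulrACA mulN1r opprK.
apply: mulr_gt0; [exact/lp/mem_head | apply: IH => b bl].
by rewrite lp // inE bl orbT.
Qed.

Lemma posdef_fusion (R : realType) (p m : nat) (G : 'M[R]_(p, m))
    (B : 'M[R]_m) (x : 'rV[R]_p) :
  posdef B -> (forall i, 0 <= x 0 i) -> posdef (B + G^T *m diag_mx x *m G).
Proof.
move=> [sB pB] x0; split.
  by rewrite linearD /= sB !trmx_mul trmxK tr_diag_mx mulmxA.
move=> v v0; rewrite mulmxDr mulmxDl mxE ltr_pwDl ?pB //.
have -> : v^T *m (G^T *m diag_mx x *m G) *m v =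
    (G *m v)^T *m diag_mx x *m (G *m v) by rewrite trmx_mul !mulmxA.
rewrite mul_mx_diag mxE sumr_ge0 // => j _; rewrite !mxE mulrAC.
by rewrite mulr_ge0 // -expr2 sqr_ge0.
Qed.

Lemma continuous_sumR (R : realType) (T : topologicalType) (I : Type)
    (r : seq I) (f : I -> T -> R) :
  (forall i, continuous (f i)) -> continuous (fun x => \sum_(i <- r) f i x).
Proof.
move=> fc; elim: r => [|i r IH] x.
  by under eq_fun do rewrite big_nil; exact: cvg_cst.
under eq_fun do rewrite big_cons.
by apply: cvgD; [exact: fc | exact: IH].
Qed.

Lemma continuous_prodR (R : realType) (T : topologicalType) (I : Type)
    (r : seq I) (f : I -> T -> R) :
  (forall i, continuous (f i)) -> continuous (fun x => \prod_(i <- r) f i x).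
Proof.
move=> fc; elim: r => [|i r IH] x.
  by under eq_fun do rewrite big_nil; exact: cvg_cst.
under eq_fun do rewrite big_cons.
by apply: cvgM; [exact: fc | exact: IH].
Qed.

Lemma continuous_mulR (R : realType) (T : topologicalType) (f g : T -> R) :
  continuous f -> continuous g -> continuous (fun x => f x * g x).
Proof. by move=> fc gc x; apply: cvgM; [exact: fc | exact: gc]. Qed.

Lemma continuous_addR (R : realType) (T : topologicalType) (f g : T -> R) :
  continuous f -> continuous g -> continuous (fun x => f x + g x).
Proof. by move=> fc gc x; apply: cvgD; [exact: fc | exact: gc]. Qed.

Lemma natural_bound_attained (R : realType) (p q m s : nat)
    (G : 'M[R]_(p, m)) (H : 'M[R]_(q, m)) :
  posdef (H^T *m H) -> (s - q <= p)%N ->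
  exists2 x, fusion_relaxed (s - q) x &
    natural_bound s G H = fusion_objective G (H^T *m H) x /\
    forall y, fusion_relaxed (s - q) y ->
      fusion_objective G (H^T *m H) y <= natural_bound s G H.
Proof.
set B := H^T *m H => pB; set k := (s - q)%N => kp.
have [c cF cmax] : exists2 c, c \in @fusion_relaxed R p k &
    forall t, t \in @fusion_relaxed R p k ->
      fusion_objective G B t <= fusion_objective G B c.
  apply: EVT_max_rV.
  - exists (\row_i (i < k)%:R); split.
      under eq_bigr do rewrite mxE.
      rewrite -natr_sum; congr _%:R.
      rewrite -(big_mkord xpredT (fun i => nat_of_bool (i < k)%N)).
      rewrite (big_cat_nat (leq0n k) kp) /= (@big_nat_cond _ _ _ k p) [X in (_ + X)%N]big1.
        rewrite addn0 big_nat (eq_bigr (fun=> 1%N)) => [|i /andP[_ ->] //].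
        by rewrite -big_nat sum_nat_const_nat muln1 subn0.
      by move=> i /andP[/andP[ki _] _]; rewrite ltnNge ki.
    by move=> i; rewrite mxE; case: (_ < _)%N; rewrite ?lexx ler01.
  - have -> : @fusion_relaxed R p k =
        [set x : 'rV[R]_p | forall i, `[0, 1]%classic (x ord0 i)] `&`
        (fun x : 'rV[R]_p => \sum_(i < p) x 0 i) @^-1` [set k%:R].
      apply/seteqP; split => x /=.
        by move=> [xs xb]; split => // i /=; rewrite in_itv /= xb.
      by move=> [xb xs]; split => // i; have := xb i; rewrite in_itv.
    apply: compact_closedI.
      by apply: (@rV_compact R p (fun=> `[0, 1]%classic)) => i; exact: segment_compact.
    apply: (@preimage_closed _ _ (fun x : 'rV[R]_p => \sum_(i < p) x 0 i)
      [set k%:R]); last exact: closed_eq.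
    move=> x _; apply: continuous_sumR => i; exact: coord_continuous.
  - apply/continuous_in_subspaceT => x /set_mem [_ xb].
    have det_cont : continuous
        (fun y : 'rV[R]_p => \det (B + G^T *m diag_mx y *m G)).
      have -> : (fun y : 'rV[R]_p => \det (B + G^T *m diag_mx y *m G)) =
        (fun y => \sum_(t : 'S_m) (-1) ^+ t *
          \prod_i (B i (t i) + \sum_j G j i * y 0 j * G j (t i))).
        apply/funext => y; apply: eq_bigr => t _; congr (_ * _).
        apply: eq_bigr => i _; rewrite !mxE; congr (_ + _).
        by apply: eq_bigr => j _; rewrite mul_mx_diag !mxE.
      apply: continuous_sumR => t.
      apply: continuous_mulR; first exact: cst_continuous.
      apply: continuous_prodR => i.
      apply: continuous_addR; first exact: cst_continuous.
      apply: continuous_sumR => j.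
      apply: continuous_mulR; last exact: cst_continuous.
      apply: continuous_mulR; first exact: cst_continuous.
      exact: coord_continuous.
    apply: (@continuous_comp _ _ _
      (fun y : 'rV[R]_p => \det (B + G^T *m diag_mx y *m G)) (@ln R)).
      exact: det_cont.
    apply: continuous_ln; apply/posdef_det_gt0/posdef_fusion => // i.
    by have /andP[] := xb i.
have {}cmax t : fusion_relaxed k t ->
    fusion_objective G B t <= fusion_objective G B c.
  by move=> tF; apply/cmax/mem_set.
move/set_mem: cF => cF; exists c => //.
have E : natural_bound s G H = fusion_objective G B c.
  rewrite /natural_bound /max_value -/B -/k.
  apply: xget_unique.
    by split; [exists c | move=> _ [t tF <-]; exact: cmax].
  move=> v [[t tF <-] vub]; apply/le_anti; rewrite cmax //=.
  by apply: vub; exists c.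
by split => // y yF; rewrite E; exact: cmax.
Qed.

(* Main.v *)
Require Import Defs.
From mathcomp Require Import all_boot all_order all_algebra.
From mathcomp Require Import ring.
From mathcomp Require Import all_classical all_reals all_analysis.

Import Order.TTheory GRing.Theory Num.Theory.
Local Open Scope ring_scope.

(** Since [x <= 1], [B + G^T Diag(x) G] lies below [B + G^T G] in the Loewner
    order, so the natural bound is at most
    [ldet (B + G^T G) = ldet B + ldet (1 + G B^-1 G^T)].  The matrix
    [G B^-1 G^T] is positive semidefinite and has at most [m <= s - q] nonzero
    eigenvalues, so this is exactly the spectral bound. *)

(** Both sides are [a ^+ m * \det X] for the block matrix [X] below: block elimination from the
    right gives [a%:M - U *m V], elimination from the left gives [a%:M - V *m U]. No division by [a]
    occurs, so [a] may be an indeterminate. *)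
Lemma det_scalar_sub_mulmxC (A : comNzRingType) (p m : nat) (a : A)
    (U : 'M[A]_(p, m)) (V : 'M[A]_(m, p)) :
  a ^+ m * \det (a%:M - U *m V) = a ^+ p * \det (a%:M - V *m U).
Proof.
pose X := block_mx a%:M U V 1%:M.
have <- : \det X = \det (a%:M - U *m V).
  have := congr1 determinant (mulmx_block a%:M U V 1%:M 1%:M 0 (- V) 1%:M).
  rewrite !(mulmx1, mul1mx, mulmx0, add0r, mulmxN) subrr.
  by rewrite det_ublock det_mulmx det_lblock !det1 !mulr1.
have := congr1 determinant (mulmx_block 1%:M 0 (- V) a%:M a%:M U V 1%:M).
rewrite !(mulmx1, mul1mx, mul0mx, addr0, mulNmx) scalar_mxC addNr.
rewrite det_ublock det_mulmx det_lblock det1 !det_scalar mul1r => ->.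
by rewrite [- _ + _]addrC.
Qed.

Lemma det_add1_mulmxC (A : comNzRingType) (p m : nat)
    (U : 'M[A]_(p, m)) (V : 'M[A]_(m, p)) :
  \det (1%:M + U *m V) = \det (1%:M + V *m U).
Proof.
have := det_scalar_sub_mulmxC _ _ _ 1 (- U) V.
by rewrite !expr1n !mul1r mulNmx mulmxN !opprK.
Qed.

Lemma mup_prod_XsubC (F : fieldType) (x : F) (l : seq F) :
  mup x (\prod_(a <- l) ('X - a%:P)) = count_mem x l.
Proof.
elim: l => [|a l IH]; first by rewrite big_nil mupNroot // root1.
rewrite big_cons /= mupM ?polyXsubC_eq0 ?IH //.
  by rewrite -['X - a%:P]expr1 mup_XsubCX; case: eqP.
by apply/monic_neq0/monic_prod_XsubC.
Qed.

Lemma is_spectrum_size (R : realType) (n : nat) (S : 'M[R]_n) (l : seq R) :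
  is_spectrum S l -> size l = n.
Proof.
by move=> [_ cl]; have := size_char_poly S; rewrite cl size_prod_XsubC => -[].
Qed.

(** Evaluate the characteristic polynomial at -1; the signs cancel factor by factor. *)
Lemma is_spectrum_det_add1 (R : realType) (n : nat) (S : 'M[R]_n) (l : seq R) :
  is_spectrum S l -> \det (1%:M + S) = \prod_(a <- l) (1 + a).
Proof.
move=> lS; have [_ cl] := lS.
apply: (can_inj (signrMK n)).
have -> : (-1) ^+ n * \det (1%:M + S) = (char_poly S).[-1].
  rewrite -detZ -[RHS]/(horner_eval (-1) _) -det_map_mx; congr (\det _).
  apply/matrixP => i j; rewrite !mxE /= /horner_eval !hornerE.
  by rewrite hornerMn hornerX mulN1r opprD mulNrn.
rewrite cl horner_prod -(is_spectrum_size _ _ _ _ lS).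
elim: l {lS cl} => [|a l IH]; first by rewrite !big_nil mulr1.
rewrite !big_cons {}IH hornerXsubC /= exprS; ring.
Qed.

Lemma is_spectrum_ge0 (R : realType) (n : nat) (S : 'M[R]_n) (l : seq R) :
  (forall v : 'rV[R]_n, 0 <= (v *m S *m v^T) 0 0) -> is_spectrum S l ->
  {in l, forall a, 0 <= a}.
Proof.
move=> S0 [_ cl] a al.
have : root (char_poly S) a by rewrite cl root_prod_XsubC.
rewrite -eigenvalue_root_char => /eigenvalueP[v vS v0].
have := S0 v; rewrite vS -scalemxAl mxE pmulr_lge0 //.
rewrite mxE (eq_bigr (fun j => v 0 j ^+ 2)) => [|j _]; last by rewrite mxE.
have sq0 j : true -> 0 <= v 0 j ^+ 2 by move=> _; exact: sqr_ge0.
rewrite lt_def sumr_ge0 // andbT; apply: contra_neq v0 => /psumr_eq0P-/(_ sq0) e.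
by apply/rowP => j; apply/eqP; rewrite mxE -sqrf_eq0 e.
Qed.

(** The substitution [u = invmx C *m w^T] turns the form of [invmx C] at [w] into the form of [C] at
    [u]. *)
Lemma posdef_inv_ge0 (R : realType) (n : nat) (C : 'M[R]_n) (w : 'rV[R]_n) :
  posdef C -> 0 <= (w *m invmx C *m w^T) 0 0.
Proof.
move=> pC; have [sC C0] := pC.
have Cu : C \in unitmx by rewrite unitmxE unitfE gt_eqF // posdef_det_gt0.
pose u : 'cV_n := invmx C *m w^T.
have wE : w = u^T *m C by rewrite trmx_mul trmxK trmx_inv sC mulmxKV.
have -> : w *m invmx C *m w^T = u^T *m C *m u by rewrite -wE -mulmxA.
by have [->|/C0/ltW//] := eqVneq u 0; rewrite mulmx0 mxE.
Qed.

Lemma posdef_conj_inv_ge0 (R : realType) (p m : nat) (C : 'M[R]_m)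
    (K : 'M[R]_(p, m)) (v : 'rV[R]_p) :
  posdef C -> 0 <= (v *m (K *m invmx C *m K^T) *m v^T) 0 0.
Proof.
by move=> pC; have := posdef_inv_ge0 _ _ _ (v *m K) pC; rewrite trmx_mul !mulmxA.
Qed.

Lemma trmx_conj_inv (R : realType) (p m : nat) (C : 'M[R]_m)
    (K : 'M[R]_(p, m)) :
  posdef C -> (K *m invmx C *m K^T)^T = K *m invmx C *m K^T.
Proof. by case=> sC _; rewrite !trmx_mul trmxK trmx_inv sC mulmxA. Qed.

(** Factor out [C], then swap the factors [invmx C *m K^T] and [K] under the determinant. *)
Lemma det_add_gram (R : realType) (p m : nat) (C : 'M[R]_m)
    (K : 'M[R]_(p, m)) :
  posdef C ->
  \det (C + K^T *m K) = \det C * \det (1%:M + K *m invmx C *m K^T).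
Proof.
move=> pC.
have Cu : C \in unitmx by rewrite unitmxE unitfE gt_eqF // posdef_det_gt0.
rewrite -mulmxA det_add1_mulmxC -det_mulmx mulmxDr mulmx1 -!mulmxA.
by rewrite (mulmxA C) mulmxV // mul1mx.
Qed.

(** The ratio of the two determinants is a product of factors [1 + a] over eigenvalues [a >= 0]. *)
Lemma posdef_le_det_add_gram (R : realType) (p m : nat) (C : 'M[R]_m)
    (K : 'M[R]_(p, m)) :
  posdef C -> \det C <= \det (C + K^T *m K).
Proof.
move=> pC; rewrite det_add_gram // ler_peMr ?(ltW (posdef_det_gt0 pC)) //.
have [l lS] := spectrum_symmetric (trmx_conj_inv _ _ _ _ K pC).
have l0 := is_spectrum_ge0 _ _ _ _ (posdef_conj_inv_ge0 _ _ _ _ K ^~ pC) lS.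
rewrite (is_spectrum_det_add1 _ _ _ _ lS).
elim: l l0 {lS} => [|a l IH] l0; first by rewrite big_nil.
rewrite big_cons mulr_ege1 //; first by rewrite lerDl l0 ?mem_head.
by apply: IH => b bl; rewrite l0 // inE bl orbT.
Qed.

Lemma posdef_le_det_fusion (R : realType) (p m : nat) (G : 'M[R]_(p, m))
    (B : 'M[R]_m) (x : 'rV[R]_p) :
  posdef B -> (forall i, 0 <= x 0 i <= 1) ->
  \det (B + G^T *m diag_mx x *m G) <= \det (B + G^T *m G).
Proof.
(* The square root of [1 - x] writes the gap between the two matrices as the Gram term [K^T *m K]
   with [K = diag_mx d *m G]. *)
move=> pB x01; pose d : 'rV[R]_p := \row_i Num.sqrt (1 - x 0 i).
have -> : B + G^T *m G =
    B + G^T *m diag_mx x *m G + (diag_mx d *m G)^T *m (diag_mx d *m G).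
  rewrite -addrA; congr (_ + _).
  rewrite trmx_mul tr_diag_mx -!mulmxA -mulmxDr (mulmxA (diag_mx d)) -mulmxDl.
  rewrite mulmx_diag -raddfD /= -[LHS](congr1 (mulmx G^T) (mul1mx G)).
  rewrite -diag_const_mx; congr (_ *m (diag_mx _ *m _)).
  apply/rowP => i; rewrite !mxE -expr2 sqr_sqrtr; first by rewrite addrC subrK.
  by rewrite subr_ge0; have /andP[] := x01 i.
by apply/posdef_le_det_add_gram/posdef_fusion => // i; have /andP[] := x01 i.
Qed.

(** Compare the multiplicity of the root 0 in ['X^m * char_poly (U *m V) = 'X^p * char_poly (V *m
    U)], which is the determinant identity at [a = 'X]. *)
Lemma count0_spectrum_mulmx (R : realType) (p m : nat)
    (U : 'M[R]_(p, m)) (V : 'M[R]_(m, p)) (l : seq R) :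
  is_spectrum (U *m V) l -> (p - m <= count_mem 0%R l)%N.
Proof.
move=> [_ cl].
have e : 'X^m * \prod_(a <- l) ('X - a%:P) = 'X^p * char_poly (V *m U).
  rewrite -cl /char_poly /char_poly_mx !map_mxM.
  exact: det_scalar_sub_mulmxC.
have l0 : \prod_(a <- l) ('X - a%:P) != 0 by apply/monic_neq0/monic_prod_XsubC.
have Xn0 n : 'X^n != 0 :> {poly R} by rewrite monic_neq0 ?monicXn.
rewrite leq_subLR -mup_prod_XsubC.
have -> : m = mup 0 ('X^m : {poly R}) by rewrite -['X]subr0 mup_XsubCX eqxx.
rewrite -mupM // e mup_geq ?subr0 ?dvdp_mulr //.
by rewrite mulf_neq0 // monic_neq0 ?char_poly_monic.
Qed.

(** If the entry at [i] were positive, sorting would make all entries up to [i] positive, leaving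
    fewer than [size l - c] places for zeros. *)
Lemma nth_eq0_count0 (R : realDomainType) (l : seq R) (c i : nat) :
  sorted >=%R l -> {in l, forall a, 0 <= a} ->
  (size l - c <= count_mem 0%R l)%N -> (c <= i)%N -> l`_i = 0.
Proof.
move=> sl l0 hc ci; have [il|li] := ltnP i (size l); last exact: nth_default.
apply/eqP/contraT => li0.
have li : 0 < l`_i by rewrite lt_def li0 l0 // mem_nth.
have : count_mem 0 (take i.+1 l) = 0%N.
  apply/eqP; rewrite -leqn0 leqNgt -has_count; apply/hasPn => a.
  move=> /(nthP 0)[j]; rewrite size_take_min.
  move=> /leq_trans-/(_ _ (geq_minl _ _)) ji.
  rewrite nth_take // => <- /=; rewrite gt_eqF // (lt_le_trans li) //.
  apply: (sorted_leq_nth (leT := >=%R)) => //; first exact: rev_trans le_trans.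
  - by move=> x; exact: lexx.
  - by rewrite inE (leq_ltn_trans _ il).
move=> t0; move: hc; rewrite -{2}(cat_take_drop i.+1 l) count_cat t0 add0n.
move=> /leq_trans-/(_ _ (count_size _ _)); rewrite size_drop.
by rewrite leqNgt ltn_sub2l ?(leq_ltn_trans ci).
Qed.

Theorem theorem16 (R : realType) (p q m s : nat)
  (G : 'M[R]_(p, m)) (H : 'M[R]_(q, m))
  (B_posdef : posdef (H^T *m H))
  (s_gt : (0 < s - q)%N) (s_lt : (s - q < p)%N)
  (m_ge1 : (1 <= m)%N) (s_ge : (m <= s - q)%N) :
  natural_bound s G H <= spectral_bound s G H.
Proof.
have [x [_ x01] [-> _]] := natural_bound_attained G B_posdef (ltnW s_lt).
rewrite /spectral_bound; set B := H^T *m H in B_posdef *; set k := (s - q)%N.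
have Bx : posdef (B + G^T *m diag_mx x *m G).
  by apply: posdef_fusion => // i; have /andP[] := x01 i.
have detx := posdef_le_det_fusion _ _ _ G B x B_posdef x01.
(* [ln] is monotone only on positive reals, so both determinants must be known positive. *)
have detG := lt_le_trans (posdef_det_gt0 Bx) detx.
apply: (@le_trans _ _ (ldet (B + G^T *m G))).
  by rewrite /fusion_objective /ldet ler_ln ?posrE ?(posdef_det_gt0 Bx).
have [l lS] := spectrum_symmetric (trmx_conj_inv _ _ _ _ G B_posdef).
have l0 := is_spectrum_ge0 _ _ _ _
  (posdef_conj_inv_ge0 _ _ _ _ G ^~ B_posdef) lS.
have szl := is_spectrum_size _ _ _ _ lS.
(* Reassociated as [G *m (invmx B *m G^T)], the matrix factors through dimension [m]; indices of [l]
   start at 0. *)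
have lm i : (m <= i)%N -> l`_i = 0.
  apply: nth_eq0_count0 => //; first by case: lS.
  by rewrite szl; apply: count0_spectrum_mulmx (lS); rewrite -mulmxA.
(* Since [m <= k], the factors from index [k] on are all 1, so truncating the product loses
   nothing. *)
have detS : \det (1%:M + G *m invmx B *m G^T) = \prod_(0 <= i < k) (1 + l`_i).
  rewrite (is_spectrum_det_add1 _ _ _ _ lS) (big_nth 0) szl.
  rewrite (big_cat_nat (leq0n k) (ltnW s_lt)) /= [X in _ * X]big_nat.
  rewrite [X in _ * X]big1 ?mulr1 // => i /andP[ki _].
  by rewrite lm ?addr0 // (leq_trans s_ge).
(* The default value 0 of [nth] covers indices past the end of [l]. *)
have nthl0 i : 0 <= l`_i.
  have [il|li] := ltnP i (size l); last by rewrite nth_default.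
  by rewrite l0 // mem_nth.
have ln_prod n :
    ln (\prod_(0 <= i < n) (1 + l`_i)) = \sum_(0 <= i < n) ln (1 + l`_i).
  elim: n => [|n IH]; first by rewrite !big_geq // ln1.
  rewrite !big_nat_recr //= lnM ?IH // posrE ?ltr_pwDl //.
  by apply: prodr_gt0 => i _; rewrite ltr_pwDl.
rewrite /ldet det_add_gram // detS lnM ?posrE ?posdef_det_gt0 //; last first.
  by apply: prodr_gt0 => i _; rewrite ltr_pwDl.
(* The shift by one matches the [i.-1] in [lambda]; the terms then agree because the spectrum is
   unique, so [xget] returns [l]. *)
rewrite ln_prod lerD2l big_add1 /=; apply: ler_sum => i _.
rewrite /lambda (_ : xget _ _ = l) //.
by apply: xget_unique => // l' lS'; exact: is_spectrum_uniq lS' lS.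
Qed.
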